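(* Let $\mathcal M$ be a class of probability distributions on an observation domain $\mathsf O$, let $\mathsf A_{\mathrm{sel}}$ be a set, and let $T\colon\mathcal M\to2^{\mathsf A_{\mathrm{sel}}}$. If $T$ is selectively elicitable on $\mathcal M'\subseteq\mathcal M$, then $T$ satisfies the selective CxLS* property on $\mathcal M'$.
   Context: For a selective scoring function $S\colon\mathsf A_{\mathrm{sel}}\times\mathsf O\to(-\infty,\infty]$, put $\bar S(x,F)=\int S(x,y)\,dF(y)$, assumed to exist in $(-\infty,\infty]$. All scoring functions are assumed $\mathcal M'$-finite: $\bar S(x,F)<\infty$ for all $x\in\mathsf A_{\mathrm{sel}}$, $F\in\mathcal M'$. $S$ is strictly $\mathcal M'$-consistent for $T$ if $\bar S(t,F)\le\bar S(x,F)$ for all $x\in\mathsf A_{\mathrm{sel}}$, $t\in T(F)$, $F\in\mathcal M'$, and equality implies $x\in T(F)$. $T$ is selectively elicitable on $\mathcal M'$ if such an $S$ exists. $T$ has the selective CxLS* property on $\mathcal M'$ if for all $F_0,F_1\in\mathcal M'$ and all $\lambda\in(0,1)$ with $(1-\lambda)F_0+\lambda F_1\in\mathcal M'$: $$T(F_0)\cap T(F_1)\ne\emptyset\ \Longrightarrow\ T(F_0)\cap T(F_1)=T\big((1-\lambda)F_0+\lambda F_1\big).$$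
   Formalization: The formal statement additionally assumes that T(F) is non-empty for every F in M'; without this the claim fails, since strict consistency is vacuous where T(F) is empty (e.g. S = 0, one action, T empty only at the mixture). *)

(* Defs.v *)
From HB Require Import structures.
From mathcomp Require Import all_boot all_order all_algebra.
From mathcomp Require Import all_classical all_reals all_analysis.
From mathcomp Require Import measurable_realfun.
Set Implicit Arguments.
Unset Strict Implicit.
Unset Printing Implicit Defensive.
Import Order.TTheory GRing.Theory Num.Theory.
Import numFieldNormedType.Exports.
Local Open Scope classical_set_scope.
Local Open Scope ring_scope.
Local Open Scope ereal_scope.

Section selective.
Context {d : measure_display} {O : measurableType d} {R : realType}.
Context {A : Type} {M : set (probability O R)}.

Definition expected_score (S : A -> O -> \bar R) (x : A)
  (F : probability O R) : \bar R := \int[F]_y S x y.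

(* The library integral is total; an integral which exists in ]-oo, +oo] is
   that of a measurable function whose negative part is integrable. *)
Definition expected_score_exists (S : A -> O -> \bar R) (x : A)
    (F : probability O R) : Prop :=
  measurable_fun setT (S x) /\ \int[F]_y (S x)^\- y < +oo.

Definition scoring_function (S : A -> O -> \bar R) (M' : set M) : Prop :=
  [/\ forall x y, -oo < S x y,
      forall (x : A) (F : M), M' F -> expected_score_exists S x (val F) &
      forall (x : A) (F : M), M' F -> expected_score S x (val F) < +oo].

Definition strictly_consistent (S : A -> O -> \bar R) (T : M -> set A)
    (M' : set M) : Prop :=
  forall (x t : A) (F : M), M' F -> T F t ->
    expected_score S t (val F) <= expected_score S x (val F) /\
    (expected_score S t (val F) = expected_score S x (val F) -> T F x).

Definition selectively_elicitable (T : M -> set A) (M' : set M) : Prop :=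
  exists S : A -> O -> \bar R,
    scoring_function S M' /\ strictly_consistent S T M'.

(* Probabilities are functions on all sets, but only their values on measurable
   sets are meaningful: F is a mixture as soon as it is one on those sets. *)
Definition is_mixture (l : R) (F0 F1 F : probability O R) : Prop :=
  forall B : set O, measurable B ->
    F B = (1 - l)%:E * F0 B + l%:E * F1 B.

Definition selective_CxLS_star (T : M -> set A) (M' : set M) : Prop :=
  forall (F0 F1 F : M) (l : R), M' F0 -> M' F1 -> (0 < l < 1)%R ->
    M' F -> is_mixture l (val F0) (val F1) (val F) ->
    T F0 `&` T F1 !=set0 -> T F0 `&` T F1 = T F.

End selective.

(* Main.v *)
Require Import Defs.
From HB Require Import structures.
From mathcomp Require Import all_boot all_order all_algebra.
From mathcomp Require Import all_classical all_reals all_analysis.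
From mathcomp Require Import measurable_realfun ring lra.
Import Order.TTheory GRing.Theory Num.Theory.
Local Open Scope ring_scope.
Local Open Scope classical_set_scope.

(** The expected score is an affine function of the distribution. If [t] lies in
    both [T F0] and [T F1], then [t] minimises the expected score under [F0] and
    under [F1], hence under the mixture [F]; comparing with an element of [T F],
    which exists, strictness puts [t] in [T F]. If [x] is in [T F], then
    its expected score under [F] equals that of [t], and as neither component
    of [x] is below that of [t] and both weights are positive, they are equal;
    so [x] lies in both [T F0] and [T F1] by strictness. *)

(** Since [f^\-] has a finite integral, an upper bound on the integral of [f] bounds that of [f^\+],
    hence that of [f^\+ + f^\-], the absolute value. *)
Lemma integrable_of_funeneg (d : measure_display) (O : measurableType d)
    (R : realType) (m : {measure set O -> \bar R}) (f : O -> \bar R) :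
  measurable_fun setT f ->
  (\int[m]_x (f^\- x) < +oo)%E -> (\int[m]_x f x < +oo)%E ->
  m.-integrable setT f.
Proof.
move=> mf negf intf; apply/integrableP; split => //.
have neg_fin : (\int[m]_x f^\- x)%E \is a fin_num.
  by rewrite ge0_fin_numE//; exact: integral_ge0.
rewrite (eq_integral (fun x => f^\+ x + f^\- x)%E) => [|x _]; last first.
  by rewrite -[LHS]/((abse \o f) x) fune_abse.
rewrite ge0_integralD//.
- rewrite lte_add_pinfty//.
  (* Moving the finite integral of [f^\-] across leaves [+oo] plus a real, which computes to
     [+oo]. *)
  by move: intf; rewrite integralE lteBlDr// -(fineK neg_fin).
- exact: measurable_funepos.
- exact: measurable_funeneg.
Qed.

Lemma integral_mixture (d : measure_display) (O : measurableType d)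
    (R : realType) (a b : {nonneg R}) (m0 m1 m : {measure set O -> \bar R})
    (f : O -> \bar R) :
  (forall B, measurable B ->
     m B = (a%:num%:E * m0 B + b%:num%:E * m1 B)%E) ->
  m0.-integrable setT f -> m1.-integrable setT f ->
  (\int[m]_x f x =
    a%:num%:E * \int[m0]_x f x + b%:num%:E * \int[m1]_x f x)%E.
Proof.
move=> mE f0 f1.
have mf : measurable_fun setT f by case/integrableP: f0.
have ge0_mixture (g : O -> \bar R) : measurable_fun setT g ->
    (forall x, 0 <= g x)%E ->
    (\int[m]_x g x =
      a%:num%:E * \int[m0]_x g x + b%:num%:E * \int[m1]_x g x)%E.
  move=> mg g0.
  (* An integral depends only on the values of the measure on measurable sets, so [m] may be
     replaced by a sum of scaled measures. *)
  rewrite (@eq_measure_integral _ _ _ setT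
    (measure_add (mscale a m0) (mscale b m1))); last first.
    by move=> B mB _; rewrite [RHS]measure_addE mE.
  by rewrite ge0_integral_measure_add// !ge0_integral_mscale.
rewrite !(integralE _ setT f) !ge0_mixture//;
  [|exact: measurable_funeneg|exact: measurable_funepos].
have fin (mu : {measure set O -> \bar R}) : mu.-integrable setT f ->
    (\int[mu]_x f^\+ x)%E \is a fin_num /\ (\int[mu]_x f^\- x)%E \is a fin_num.
  by move=> muf; split; apply: integrable_fin_num => //;
    [exact: integrable_funepos|exact: integrable_funeneg].
(* All four integrals are finite, so the terms can be regrouped in [R], with no risk of
   [+oo - +oo]. *)
have [/fineK <- /fineK <-] := fin _ f0.
have [/fineK <- /fineK <-] := fin _ f1.
by rewrite -!EFinM -!EFinD; congr EFin; ring.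
Qed.

(** Neither weighted term on the left is below its counterpart on the right, so neither can exceed
    it; the positive weights then cancel. *)
Lemma convex_comb_le_eq {R : realFieldType} {l t0 t1 x0 x1 : R} :
  (0 < l < 1)%R -> (t0 <= x0)%R -> (t1 <= x1)%R ->
  ((1 - l) * x0 + l * x1 <= (1 - l) * t0 + l * t1)%R ->
  t0 = x0 /\ t1 = x1.
Proof.
move=> /andP[l0 l1] tx0 tx1 h.
have l'0 : (0 < 1 - l)%R by rewrite subr_gt0.
have := tx0; rewrite -(ler_pM2l l'0) => ltx0.
have := tx1; rewrite -(ler_pM2l l0) => ltx1.
split; apply/eqP; rewrite eq_le ?tx0 ?tx1 /=.
- by rewrite -(ler_pM2l l'0); lra.
- by rewrite -(ler_pM2l l0); lra.
Qed.

Section expected_score.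
Context {d : measure_display} {O : measurableType d} {R : realType}.
Context {A : Type} {M : set (probability O R)}.
Context {S : A -> O -> \bar R} {M' : set M}.
Context (SM' : scoring_function S M').

Lemma scoring_function_integrable (x : A) {F : M} :
  M' F -> (val F).-integrable setT (S x).
Proof.
have [_ Sex Sfin] := SM' => M'F.
have [mS negS] := Sex x F M'F.
by apply: integrable_of_funeneg => //; exact: Sfin.
Qed.

Lemma expected_score_fin_num (x : A) {F : M} :
  M' F -> expected_score S x (val F) \is a fin_num.
Proof.
move=> M'F; apply: integrable_fin_num => //.
exact: scoring_function_integrable.
Qed.

Lemma expected_score_mixture {l : R} {F0 F1 F : M} (x : A) :
  (0 < l < 1)%R -> M' F0 -> M' F1 -> is_mixture l (val F0) (val F1) (val F) ->
  expected_score S x (val F) =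
    ((1 - l)%:E * expected_score S x (val F0) +
     l%:E * expected_score S x (val F1))%E.
Proof.
move=> /andP[l0 l1] M'F0 M'F1 mix.
have l'0 : (0 <= 1 - l)%R by rewrite subr_ge0 ltW.
by apply: (@integral_mixture _ _ _ (NngNum l'0) (NngNum (ltW l0)));
  [exact: mix|exact: scoring_function_integrable..].
Qed.

End expected_score.

Theorem proposition3p3 (d : measure_display) (O : measurableType d)
    (R : realType) (A : Type) (M : set (probability O R))
    (T : M -> set A) (M' : set M)
    (T_neq0 : forall F : M, M' F -> T F !=set0) :
  selectively_elicitable T M' -> selective_CxLS_star T M'.
Proof.
move=> [S [SM' Scons]] F0 F1 F l M'F0 M'F1 l01 M'F mix [t [T0t T1t]].
have mixE x := expected_score_mixture SM' x l01 M'F0 M'F1 mix.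
have fin0 x := fineK (expected_score_fin_num SM' x M'F0).
have fin1 x := fineK (expected_score_fin_num SM' x M'F1).
apply/seteqP; split => [u [T0u T1u]|x TFx].
- have [s TFs] := T_neq0 F M'F.
  have [su] := Scons u s F M'F TFs; apply.
  apply/eqP; rewrite eq_le su !mixE /=.
  have /andP[l0 l1] := l01.
  (* What remains is that [u] scores at most [s] under [F], which holds in each component. *)
  apply: leeD; apply: lee_wpmul2l;
    rewrite ?lee_fin ?subr_ge0 ?(ltW l0) ?(ltW l1)//.
  + by have [] := Scons s u F0 M'F0 T0u.
  + by have [] := Scons s u F1 M'F1 T1u.
- have [xt _] := Scons t x F M'F TFx.
  have [tx0 T0x] := Scons x t F0 M'F0 T0t.
  have [tx1 T1x] := Scons x t F1 M'F1 T1t.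
  move: xt tx0 tx1 T0x T1x.
  (* Finite scores turn the three inequalities into real ones, where terms cancel. *)
  rewrite !mixE -(fin0 x) -(fin0 t) -(fin1 x) -(fin1 t) -!EFinM -!EFinD.
  rewrite !lee_fin => xt tx0 tx1 T0x T1x.
  have [e0 e1] := convex_comb_le_eq l01 tx0 tx1 xt.
  by split; [apply: T0x; rewrite e0|apply: T1x; rewrite e1].
Qed.
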